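(* Let $G=(V,E)$ be an undirected $d$-regular $\beta$-expander with $n$ vertices, where $d$ and $\beta$ are constant. Then the randomized query complexity of local search on $G$ is $\Omega\left(\frac{\sqrt{n}}{\log n}\right)$. (That is, for all fixed $d\in\mathbb{N}$ and $\beta>0$ there are constants $c>0$ and $n_0$ depending only on $d,\beta$ such that the randomized query complexity is at least $c\sqrt{n}/\log n$ for every such $G$ with $n\ge n_0$.)
   Context: Local search: $G=(V,E)$ is a finite connected undirected graph known to the algorithm, and $f:V\to\mathbb{R}$ is an unknown function accessible through an oracle; a query names a vertex $v$ and receives $f(v)$. A vertex $v$ is a local minimum if $f(v)\le f(u)$ for all $\{u,v\}\in E$. The task is to output a local minimum. Randomized query complexity: the minimum over randomized algorithms that, for every input $f$, output a correct solution with probability at least $9/10$, of the worst-case (over inputs) expected number of queries, the expectation being over the algorithm's coin tosses. Expander: for $S\subseteq V$ let $E(S,V\setminus S)=\{(u,v)\in E\mid u\in S,\ v\notin S\}$. The graph is a $\beta$-expander (with $\beta>0$) if $|E(S,V\setminus S)|\ge\beta\cdot|S|$ for all $S\subseteq V$ with $0<|S|\le n/2$. The graph is $d$-regular if each vertex has degree $d$. *)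

(* Defs.v *)
From HB Require Import structures.
From mathcomp Require Import all_boot all_order all_algebra.
From mathcomp Require Import all_classical all_reals all_analysis.

Set Implicit Arguments.
Unset Strict Implicit.
Unset Printing Implicit Defensive.

Import Order.TTheory GRing.Theory Num.Theory.
Local Open Scope classical_set_scope.
Local Open Scope ring_scope.

Definition simple_graph (V : finType) (e : rel V) : Prop :=
  symmetric e /\ irreflexive e.

Definition regular (V : finType) (e : rel V) (d : nat) : Prop :=
  forall v, #|[set u | e v u]%SET| = d.

Definition edge_boundary (V : finType) (e : rel V) (S : {set V}) :
    {set V * V} :=
  [set p : V * V | [&& e p.1 p.2, p.1 \in S & p.2 \notin S]]%SET.

(* A graph satisfying this with 0 < beta is connected: a connected component *)
(* with at most half of the vertices would have an empty edge boundary.      *)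
Definition expander (R : realType) (V : finType) (e : rel V) (beta : R) :
    Prop :=
  forall S : {set V}, (0 < #|S|)%N -> #|S|%:R <= #|V|%:R / 2 :> R ->
    beta * #|S|%:R <= #|edge_boundary e S|%:R.

Definition local_min (R : realType) (V : finType) (e : rel V) (f : V -> R)
    (v : V) : Prop :=
  forall u, e v u -> f v <= f u.

Inductive action (V : Type) : Type :=
  | Query of V
  | Output of V.

(* A deterministic algorithm chooses its next action from the list of the    *)
(* (vertex, answer) pairs seen so far, in chronological order. It may depend *)
(* arbitrarily on the graph, and it need not halt.                           *)
Definition det_alg (R : realType) (V : finType) : Type :=
  seq (V * R) -> action V.

(* After Output the history no longer changes. *)
Fixpoint history (R : realType) (V : finType) (A : det_alg R V) (f : V -> R)
    (t : nat) : seq (V * R) :=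
  if t is t'.+1 then
    let h := history A f t' in
    if A h is Query v then rcons h (v, f v) else h
  else [::].

Definition outputs (R : realType) (V : finType) (A : det_alg R V) (f : V -> R)
    (v : V) : Prop :=
  exists t, A (history A f t) = Output v.

(* Repeated queries are counted; the value is +oo on a run without output. *)
Definition num_queries (R : realType) (V : finType) (A : det_alg R V)
    (f : V -> R) : \bar R :=
  ereal_sup (range (fun t => (size (history A f t))%:R%:E)).

(* The coin tosses are a point of an arbitrary probability space. The last   *)
(* field makes the action after each history a random variable.              *)
Record rand_alg (R : realType) (V : finType) : Type := RandAlg {
  coin_display : measure_display;
  coins : measurableType coin_display;
  coin_law : probability coins R;
  alg_of_coins : coins -> det_alg R V;
  alg_of_coins_measurable : forall (h : seq (V * R)) (a : action V),
    measurable [set w | alg_of_coins w h = a]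
}.
Arguments alg_of_coins {R V} A w h : rename.

Definition success_prob (R : realType) (V : finType) (e : rel V)
    (A : rand_alg R V) (f : V -> R) : \bar R :=
  coin_law A [set w | exists v,
    outputs (alg_of_coins A w) f v /\ local_min e f v].

Definition solves_local_search (R : realType) (V : finType) (e : rel V)
    (A : rand_alg R V) : Prop :=
  forall f : V -> R, ((9 / 10 : R)%:E <= success_prob e A f)%E.

Definition expected_queries (R : realType) (V : finType) (A : rand_alg R V)
    (f : V -> R) : \bar R :=
  (\int[coin_law A]_w num_queries (alg_of_coins A w) f)%E.

Definition worst_case_queries (R : realType) (V : finType)
    (A : rand_alg R V) : \bar R :=
  ereal_sup (range (expected_queries A)).

Definition randomized_query_complexity (R : realType) (V : finType)
    (e : rel V) : \bar R :=
  ereal_inf [set q : \bar R | exists2 A : rand_alg R V,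
    solves_local_search e A & q = worst_case_queries A].

(* Main.v *)
Require Import Defs.
From HB Require Import structures.
From mathcomp Require Import all_boot all_order all_algebra.
From mathcomp Require Import all_classical all_reals all_analysis.
From mathcomp Require Import measurable_realfun ring lra zify.

Set Implicit Arguments.
Unset Strict Implicit.
Unset Printing Implicit Defensive.

Import Order.TTheory GRing.Theory Num.Theory.
Local Open Scope classical_set_scope.
Local Open Scope ring_scope.

(* By Yao's principle it suffices to find a random f that is hard for every  *)
(* deterministic algorithm. Let X_0, ..., X_L be a lazy random walk, and let *)
(* f descend along it: f is minus the time of the last visit on the walk,    *)
(* and a positive height leading back to X_0 elsewhere, so that X_L is the   *)
(* only local minimum. On an expander the walk mixes within M = O(log n)     *)
(* steps. Let the i-th query be computed from f truncated to the first i M   *)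
(* steps; the part of the walk after time (i+1) M is nearly uniform given    *)
(* those, so it avoids the i-th query except with probability O(L/n). If     *)
(* this happens for all i <= N, the truncated answers are the true ones and  *)
(* the algorithm has learnt nothing about X_L, where L = (N+1) M. The union  *)
(* bound N L / n is small for N of order sqrt (n / log n).                   *)

(** * Random walks *)

Section WalkExpectation.
Variables (R : realType) (V : finType) (ker : V -> V -> R).
Hypotheses (ker_ge0 : forall x y, 0 <= ker x y).
Hypotheses (ker_sum : forall x, \sum_y ker x y = 1).

(** Expectation over the [L] steps that follow [x], written as nested finite sums. No probability
    space of walks is needed, and exchanging it with sums and integrals is mere linearity. *)
Fixpoint walk_exp (L : nat) (x : V) (F : seq V -> R) : R :=
  if L is L'.+1
  then \sum_y ker x y * walk_exp L' y (fun s => F (y :: s))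
  else F [::].

Lemma walk_exp_cst L x c : walk_exp L x (fun=> c) = c.
Proof.
elim: L x => [//|L IH] x /=.
by under eq_bigr do rewrite IH; rewrite -mulr_suml ker_sum mul1r.
Qed.

Lemma walk_exp_ge0 L x F : (forall s, 0 <= F s) -> 0 <= walk_exp L x F.
Proof.
elim: L x F => [|L IH] x F F0 //=.
by apply: sumr_ge0 => y _; rewrite mulr_ge0 // IH.
Qed.

Lemma walk_exp_le L x F G :
  (forall s, size s = L -> path (fun u v => 0 < ker u v) x s -> F s <= G s) ->
  walk_exp L x F <= walk_exp L x G.
Proof.
elim: L x F G => [|L IH] x F G FG /=; first exact: FG.
apply: ler_sum => y _.
have [->|kn0] := eqVneq (ker x y) 0; first by rewrite !mul0r.
rewrite ler_wpM2l // IH // => s sL ps; apply: FG => /=; first by rewrite sL.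
by rewrite ps andbT lt_neqAle eq_sym kn0 ker_ge0.
Qed.

Lemma walk_exp_sum L x (I : Type) (r : seq I) (P : pred I) F :
  walk_exp L x (fun s => \sum_(i <- r | P i) F i s) =
  \sum_(i <- r | P i) walk_exp L x (F i).
Proof.
elim: L x F => [//|L IH] x F /=.
by under eq_bigr do rewrite IH mulr_sumr; rewrite exchange_big.
Qed.

Definition kernel_avg (h : V -> R) (x : V) : R := \sum_y ker x y * h y.

Lemma iter_kernel_avg_ge0 t (h : V -> R) x : (forall y, 0 <= h y) ->
  0 <= iter t kernel_avg h x.
Proof.
move=> h0; elim: t x => [//|t IH] x.
by apply: sumr_ge0 => y _; exact: mulr_ge0 (ker_ge0 x y) (IH y).
Qed.

Lemma walk_exp_visit L x x0 t v : (t <= L)%N ->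
  walk_exp L x (fun s => (nth x0 (x :: s) t == v)%:R) =
  iter t kernel_avg (fun y => (y == v)%:R) x.
Proof.
elim: t L x => [|t IH] [|L] x //= tL.
  by under eq_bigr do rewrite walk_exp_cst; rewrite -mulr_suml ker_sum mul1r.
by apply: eq_bigr => y _; congr (_ * _); exact: (IH L).
Qed.

Variables (M : nat) (eps : R).
Hypothesis mixed : forall t v x, (M <= t)%N ->
  iter t kernel_avg (fun y => (y == v)%:R) x <= eps.

(** By the Markov property, given the first [m] steps the walk restarts at its current vertex with
    at least [M] steps left before time [t], so it sits at any prescribed vertex with probability at
    most [eps]. The induction absorbs each known step into [g], until the guess is a fixed
    vertex. *)
Lemma walk_exp_guess L x x0 m t (g : seq V -> V) : (m + M <= t <= L)%N ->
  walk_exp L x (fun s => (nth x0 (x :: s) t == g (take m s))%:R) <= eps.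
Proof.
elim: m L t x g => [|m IH] L t x g /andP[mt tL].
  have -> : (fun s => (nth x0 (x :: s) t == g (take 0 s))%:R) =
      (fun s => (nth x0 (x :: s) t == g [::])%:R) :> (_ -> R).
    by apply/funext => s; rewrite take0.
  by rewrite walk_exp_visit ?mixed.
case: t mt tL => [|t]; first by rewrite addSn.
case: L => // L mt tL /=.
rewrite -[leRHS]mul1r -[X in _ <= X * _](ker_sum x) mulr_suml.
apply: ler_sum => y _; rewrite ler_wpM2l //.
by apply: (IH L t y (fun s => g (y :: s))); rewrite -ltnS -addSn mt.
Qed.

End WalkExpectation.

(** * Mixing on expanders *)

(** Lagrange's identity: twice the gap between the two sides is a double sum of squares. *)
Lemma cauchy_schwarz_sum (R : realDomainType) (I : finType) (P : pred I)
    (a b : I -> R) :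
  (\sum_(i | P i) a i * b i) ^+ 2 <=
  (\sum_(i | P i) a i ^+ 2) * (\sum_(i | P i) b i ^+ 2).
Proof.
have : 0 <= \sum_(i | P i) \sum_(j | P j) (a i * b j - a j * b i) ^+ 2.
  by apply: sumr_ge0 => i _; apply: sumr_ge0 => j _; exact: sqr_ge0.
have -> : \sum_(i | P i) \sum_(j | P j) (a i * b j - a j * b i) ^+ 2 =
    \sum_(i | P i) \sum_(j | P j) (a i ^+ 2 * b j ^+ 2) +
    \sum_(i | P i) \sum_(j | P j) (b i ^+ 2 * a j ^+ 2) -
    2 * \sum_(i | P i) \sum_(j | P j) (a i * b i) * (a j * b j).
  rewrite mulr_sumr -big_split -sumrB; apply: eq_bigr => i _ /=.
  rewrite mulr_sumr -big_split -sumrB; apply: eq_bigr => j _ /=.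
  by ring.
rewrite -!big_distrlr /=.
set A := \sum_(i | P i) a i ^+ 2; set B := \sum_(i | P i) b i ^+ 2.
set S := \sum_(i | P i) a i * b i; move=> h; rewrite expr2.
by rewrite [B * A]mulrC in h; lra.
Qed.

Section Mixing.
Variables (R : realType) (V : finType) (e : rel V) (d : nat) (beta : R).
Hypotheses (graph_e : simple_graph e) (reg_e : regular e d).
Hypotheses (beta_gt0 : 0 < beta) (exp_e : expander e beta).

Let e_sym : symmetric e := graph_e.1.

Lemma card_neighbors x : #|[pred y | e x y]| = d.
Proof. by rewrite -(reg_e x); apply: eq_card => y; rewrite !inE. Qed.

Lemma sum_edge_fst (F : V -> R) :
  \sum_(p : V * V | e p.1 p.2) F p.1 = d%:R * \sum_x F x.
Proof.
rewrite -(pair_big_dep xpredT e (fun x _ => F x)) /= mulr_sumr.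
by apply: eq_bigr => x _; rewrite sumr_const mulr_natl card_neighbors.
Qed.

Lemma sum_edge_swap (F : V * V -> R) :
  \sum_(p : V * V | e p.1 p.2) F p = \sum_(p : V * V | e p.1 p.2) F (p.2, p.1).
Proof.
rewrite (reindex_inj (h := fun p : V * V => (p.2, p.1))) /=.
  by apply: eq_bigl => p /=; rewrite e_sym.
by move=> [a b] [a' b'] [-> ->].
Qed.

Lemma sum_edge_snd (F : V -> R) :
  \sum_(p : V * V | e p.1 p.2) F p.2 = d%:R * \sum_x F x.
Proof. by rewrite (sum_edge_swap (fun p => F p.2)) sum_edge_fst. Qed.

(* The discrete coarea inequality: peel off the lowest positive level of g.  *)
Lemma coarea_expander (g : V -> R) : (forall x, 0 <= g x) ->
  #|[set x | 0 < g x]%SET|%:R <= #|V|%:R / 2 :> R ->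
  beta * \sum_x g x <=
  \sum_(p : V * V | e p.1 p.2) Num.max (g p.1 - g p.2) 0.
Proof.
move: {2}#|_| (leqnn #|[set x | 0 < g x]%SET|) => k.
elim: k g => [|k IH] g.
  rewrite leqn0 cards_eq0 => /eqP S0 g0 _.
  rewrite big1 ?mulr0; last first.
    move=> x _; apply/eqP; rewrite eq_le g0 andbT leNgt.
    by apply/negP => gx; have := finset.in_set0 x; rewrite -S0 inE gx.
  by apply: sumr_ge0 => p _; rewrite le_max lexx orbT.
move=> Sk g0 Shalf; set S := [set x | 0 < g x]%SET in Sk Shalf.
have inS x : (x \in S) = (0 < g x) by rewrite /S finset.inE.
have [S0|/set0Pn[x0 x0S]] := eqVneq S finset.set0.
  by apply: IH => //; rewrite -/S S0 cards0.
case: (arg_minP g x0S) => z zS zmin.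
have gz : 0 < g z by rewrite -inS.
pose g' x := if x \in S then g x - g z else 0.
have gS x : x \notin S -> g x = 0.
  by rewrite inS -leNgt => gx; apply/eqP; rewrite eq_le gx g0.
have g'0 x : 0 <= g' x.
  by rewrite /g'; case: ifP => // xS; rewrite subr_ge0 zmin.
have S'S : ([set x | 0 < g' x] \subset S :\ z)%SET.
  apply/fintype.subsetP => x; rewrite !finset.inE /g'.
  case: ifP; rewrite ?ltxx // -inS => -> h; rewrite andbT.
  by apply: contraTneq h => ->; rewrite subrr ltxx.
have cS : (#|[set x | (0 < g' x)%R]%SET| < #|S|)%N.
  by rewrite (cardsD1 z S) (zS : z \in S) ltnS subset_leq_card.
have IHg : beta * \sum_x g' x <=
    \sum_(p : V * V | e p.1 p.2) Num.max (g' p.1 - g' p.2) 0.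
  apply: IH => //; first by rewrite -ltnS (leq_trans cS).
  by apply: le_trans Shalf; rewrite ler_nat ltnW.
have bS : beta * #|S|%:R <= #|edge_boundary e S|%:R.
  by apply: exp_e => //; apply/card_gt0P; exists z.
have -> : \sum_x g x = \sum_x g' x + g z * #|S|%:R.
  rewrite mulr_natr -sumr_const [X in _ + X]big_mkcond -big_split /=.
  by apply: eq_bigr => x _; rewrite /g'; case: ifPn => [|/gS] ?; lra.
(* Lowering [g] by [g z] on its support [S] changes no difference within [S] and shrinks the drop
   along an edge leaving [S] by exactly [g z]. Edges starting outside [S] contribute zero
   throughout. *)
have -> : \sum_(p : V * V | e p.1 p.2) Num.max (g p.1 - g p.2) 0 =
    \sum_(p : V * V | e p.1 p.2) Num.max (g' p.1 - g' p.2) 0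
    + g z * #|edge_boundary e S|%:R.
  have -> : #|edge_boundary e S|%:R =
      \sum_(p : V * V | e p.1 p.2) ((p.1 \in S) && (p.2 \notin S))%:R :> R.
    rewrite -sum1_card natr_sum big_mkcond [RHS]big_mkcond /=.
    by apply: eq_bigr => p _; rewrite inE; case: (e _ _) => //=; case: (_ && _).
  rewrite mulr_sumr -big_split; apply: eq_bigr => -[x y] _ /=; rewrite /g'.
  have [xS|xS] := boolP (x \in S); have [yS|yS] := boolP (y \in S) => /=.
  - by rewrite mulr0 addr0; congr Num.max; lra.
  - rewrite (gS y) // mulr1 !subr0 !max_l ?subr_ge0 ?zmin //.
    by lra.
  - rewrite (gS x) // mulr0 !sub0r addr0 !max_r ?oppr_le0 // subr_ge0.
    exact: zmin.
  - by rewrite (gS x) // (gS y) // mulr0 addr0.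
rewrite mulrDr lerD // mulrCA ler_pM2l //.
Qed.

(** The hard direction of Cheeger's inequality: the coarea bound is applied to the square of [y],
    and Cauchy-Schwarz separates the factors of [y u ^+ 2 - y v ^+ 2]. *)
Lemma cheeger_supported (y : V -> R) : (forall x, 0 <= y x) ->
  #|[set x | 0 < y x]%SET|%:R <= #|V|%:R / 2 :> R ->
  beta ^+ 2 * \sum_x y x ^+ 2 <=
  d%:R * \sum_(p : V * V | e p.1 p.2) (y p.1 - y p.2) ^+ 2.
Proof.
move=> y0 Yhalf.
set S := \sum_x _; set D := \sum_(p | _) _.
have D0 : 0 <= D by apply: sumr_ge0 => p _; exact: sqr_ge0.
have S0 : 0 <= S by apply: sumr_ge0 => p _; exact: sqr_ge0.
pose T := \sum_(p : V * V | e p.1 p.2) Num.max (y p.1 ^+ 2 - y p.2 ^+ 2) 0.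
have bST : beta * S <= T.
  apply: (coarea_expander (g := fun x => y x ^+ 2)) => [x|].
    exact: sqr_ge0.
  apply: le_trans Yhalf; rewrite ler_nat; apply: subset_leq_card.
  apply/fintype.subsetP => x; rewrite !inE => h.
  by rewrite lt_neqAle y0 andbT eq_sym; apply: contraTneq h => ->; rewrite expr0n ltxx.
(* Reversing every ordered edge turns positive parts into negative parts; together they make
   absolute values. *)
have TT : T + T = \sum_(p : V * V | e p.1 p.2) `|y p.1 - y p.2| * (y p.1 + y p.2).
  rewrite {2}/T sum_edge_swap -big_split; apply: eq_bigr => -[u v] _ /=.
  have -> : y v ^+ 2 - y u ^+ 2 = - (y u ^+ 2 - y v ^+ 2) by ring.
  rewrite -[X in _ * X]ger0_norm ?addr_ge0 // -normrM -subr_sqr.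
  have [h|h] := leP 0 (y u ^+ 2 - y v ^+ 2).
    by rewrite max_r ?addr0 ?oppr_le0 // ger0_norm.
  by rewrite max_l ?oppr_ge0 ?ltW// add0r ltr0_norm.
have CS : (T + T) ^+ 2 <= D * (4 * d%:R * S).
  rewrite TT; apply: le_trans (cauchy_schwarz_sum _ _ _) _.
  apply: ler_pM.
  - by apply: sumr_ge0 => p _; exact: sqr_ge0.
  - by apply: sumr_ge0 => p _; exact: sqr_ge0.
  - by apply: ler_sum => p _; rewrite real_normK ?num_real.
  have -> : 4 * d%:R * S = \sum_(p : V * V | e p.1 p.2) (2 * y p.1 ^+ 2 + 2 * y p.2 ^+ 2).
    rewrite big_split /= (sum_edge_fst (fun x => 2 * y x ^+ 2)).
    by rewrite (sum_edge_snd (fun x => 2 * y x ^+ 2)) -mulr_sumr -/S; ring.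
  apply: ler_sum => p _.
  by have := sqr_ge0 (y p.1 - y p.2); nra.
have [->|Sn0] := eqVneq S 0; first by rewrite mulr0 mulr_ge0.
have Sp : 0 < S by rewrite lt_neqAle eq_sym Sn0.
have : (beta * S) ^+ 2 <= D * d%:R * S.
  have : (beta * S) ^+ 2 <= T ^+ 2.
    by rewrite lerXn2r ?nnegrE ?mulr_ge0 ?(ltW beta_gt0)// (le_trans _ bST)// mulr_ge0 // ltW.
  by nra.
move=> h; rewrite -(ler_pM2r Sp) [d%:R * D]mulrC; apply: le_trans h.
by rewrite le_eqVlt; apply/orP; left; apply/eqP; ring.
Qed.

(** Expansion is tested on a single vertex. This makes [d] positive and bounds the spectral quantity
    [gap] by 1. *)
Lemma expander_le_degree : (1 < #|V|)%N -> beta <= d%:R.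
Proof.
move=> V1; have /card_gt0P[v _] : (0 < #|V|)%N by exact: ltnW.
have := @exp_e [set v]%SET; rewrite cards1 mulr1 => /(_ isT) h.
apply: le_trans (h _) _.
  by have : (2%:R : R) <= #|V|%:R; [rewrite ler_nat | lra].
have -> : d%:R = \sum_(p : V * V | e p.1 p.2) (p.1 == v)%:R :> R.
  rewrite (sum_edge_fst (fun x => (x == v)%:R)) (bigD1 v) //= eqxx.
  by rewrite big1 ?addr0 ?mulr1 // => x /negbTE ->.
rewrite -sum1_card natr_sum big_mkcond [X in _ <= X]big_mkcond /=.
apply: ler_sum => p _; rewrite !inE; case: (e _ _) => //=.
by case: (_ == _) => //=; case: (~~ _).
Qed.

(** The walk stays put with probability 1/2, which removes the periodicity of bipartite graphs. *)
Definition lazy_kernel (x y : V) : R := ((x == y)%:R + (e x y)%:R / d%:R) / 2.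

Definition lazy_avg : (V -> R) -> V -> R := kernel_avg lazy_kernel.

Hypothesis V_gt1 : (1 < #|V|)%N.

Let d_gt0 : (0 < d%:R :> R).
Proof. exact: lt_le_trans (expander_le_degree V_gt1). Qed.

Lemma lazy_kernel_ge0 x y : 0 <= lazy_kernel x y.
Proof. by rewrite /lazy_kernel divr_ge0 // addr_ge0 // divr_ge0 // ltW. Qed.

Lemma lazy_kernelC x y : lazy_kernel x y = lazy_kernel y x.
Proof. by rewrite /lazy_kernel eq_sym e_sym. Qed.

Lemma lazy_avgE h x :
  lazy_avg h x = (\sum_(y | e x y) (h x + h y)) / (2 * d%:R).
Proof.
rewrite big_split sumr_const /= -(mulr_natl (h x)) card_neighbors.
rewrite /lazy_avg /kernel_avg /lazy_kernel.
under [LHS]eq_bigr do rewrite -mulrA mulrDl.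
rewrite big_split /= (bigD1 x) //= eqxx big1 ?addr0; last first.
  by move=> y; rewrite eq_sym => /negbTE ->; rewrite mul0r.
have -> : \sum_y (e x y)%:R / d%:R * (2^-1 * h y) = (\sum_(y | e x y) h y) / (2 * d%:R).
  rewrite mulr_suml [RHS]big_mkcond; apply: eq_bigr => y _.
  by case: (e x y) => /=; [field; rewrite lt0r_neq0|rewrite !mul0r].
by rewrite /=; field; rewrite lt0r_neq0.
Qed.

Lemma lazy_kernel_sum x : \sum_y lazy_kernel x y = 1.
Proof.
have -> : \sum_y lazy_kernel x y = lazy_avg (fun=> 1) x.
  by apply: eq_bigr => y _; rewrite mulr1.
rewrite lazy_avgE sumr_const card_neighbors.
by rewrite -mulr_natl; field; rewrite lt0r_neq0.
Qed.

Lemma lazy_avg_sum h : \sum_x lazy_avg h x = \sum_x h x.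
Proof.
rewrite /lazy_avg /kernel_avg exchange_big; apply: eq_bigr => y _ /=.
under eq_bigr do rewrite lazy_kernelC.
by rewrite -mulr_suml lazy_kernel_sum mul1r.
Qed.

(** [lazy_avg h x] is the mean of [(h x + h y) / 2] over the neighbours [y]. Its square is at most
    the mean of the squares, and the parallelogram identity exposes the Dirichlet energy that is
    lost. *)
Lemma lazy_avg_energy h :
  \sum_x lazy_avg h x ^+ 2 <= \sum_x h x ^+ 2 -
    (\sum_(p : V * V | e p.1 p.2) (h p.1 - h p.2) ^+ 2) / (4 * d%:R).
Proof.
have d0 := d_gt0.
have -> : \sum_x h x ^+ 2 - (\sum_(p : V * V | e p.1 p.2) (h p.1 - h p.2) ^+ 2) / (4 * d%:R)
    = \sum_(p : V * V | e p.1 p.2) (h p.1 + h p.2) ^+ 2 / (4 * d%:R).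
  rewrite -mulr_suml.
  have -> : \sum_x h x ^+ 2 = \sum_(p : V * V | e p.1 p.2)
       (2 * h p.1 ^+ 2 + 2 * h p.2 ^+ 2) / (4 * d%:R).
    rewrite -mulr_suml big_split /= (sum_edge_fst (fun x => 2 * h x ^+ 2)).
    rewrite (sum_edge_snd (fun x => 2 * h x ^+ 2)) -mulr_sumr.
    by field; rewrite lt0r_neq0.
  by rewrite -mulr_suml -mulrBl -sumrB; congr (_ / _); apply: eq_bigr => p _; ring.
rewrite -(pair_big_dep xpredT e (fun x y => (h x + h y) ^+ 2 / (4 * d%:R))) /=.
apply: ler_sum => x _; rewrite lazy_avgE.
have CS : (\sum_(y | e x y) (h x + h y)) ^+ 2 <=
    (\sum_(y | e x y) (h x + h y) ^+ 2) * d%:R.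
  have -> : d%:R = \sum_(y | e x y) 1 ^+ 2 :> R.
    by rewrite expr1n sumr_const card_neighbors.
  apply: le_trans (cauchy_schwarz_sum _ _ _).
  by rewrite (eq_bigr (fun y => (h x + h y) * 1)) // => y _; rewrite mulr1.
rewrite -mulr_suml.
rewrite exprMn exprVn ler_pdivrMr ?exprn_gt0 ?mulr_gt0//.
by apply: le_trans CS _; rewrite le_eqVlt; apply/orP; left; apply/eqP; field; rewrite lt0r_neq0.
Qed.

(** The energy loss has factor [1 / (4 * d)], and Cheeger bounds the energy below by [beta ^+ 2 / d]
    times the squared norm. *)
Definition gap : R := beta ^+ 2 / (4 * d%:R ^+ 2).

Lemma gap_gt0 : 0 < gap.
Proof. by rewrite /gap divr_gt0 ?mulr_gt0 ?exprn_gt0. Qed.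

Lemma gap_le1 : gap <= 1.
Proof.
rewrite /gap ler_pdivrMr ?mulr_gt0 ?exprn_gt0 // mul1r.
have : beta ^+ 2 <= d%:R ^+ 2.
  by rewrite lerXn2r ?nnegrE ?(ltW beta_gt0) ?ler0n ?expander_le_degree.
by have := sqr_ge0 (d%:R : R); lra.
Qed.

Lemma lazy_avg_contract (y : V -> R) : (forall x, 0 <= y x) ->
  #|[set x | 0 < y x]%SET|%:R <= #|V|%:R / 2 :> R ->
  \sum_x lazy_avg y x ^+ 2 <= (1 - gap) * \sum_x y x ^+ 2.
Proof.
move=> y0 Yhalf; apply: le_trans (lazy_avg_energy y) _.
have := cheeger_supported y0 Yhalf.
set S := \sum_x _; set D := \sum_(p | _) _ => h.
rewrite mulrBl mul1r lerB // /gap.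
rewrite ler_pdivlMr ?mulr_gt0 //.
apply: le_trans (_ : beta ^+ 2 * S / d%:R <= _).
  by rewrite le_eqVlt; apply/orP; left; apply/eqP; field; rewrite lt0r_neq0.
by rewrite ler_pdivrMr // [D * _]mulrC.
Qed.

(** The probability of being at [v] after [t] steps, as a function of the starting vertex. As the
    kernel is symmetric, it is also a distribution in that variable. *)
Definition walk_prob (t : nat) (v : V) : V -> R :=
  iter t lazy_avg (fun x => (x == v)%:R).

Lemma walk_prob_ge0 t v x : 0 <= walk_prob t v x.
Proof.
by apply: iter_kernel_avg_ge0 => [x' y|y]; [exact: lazy_kernel_ge0|exact: ler0n].
Qed.

Lemma walk_prob_sum t v : \sum_x walk_prob t v x = 1.
Proof.
elim: t => [|t IH] /=; last by rewrite lazy_avg_sum.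
by rewrite /walk_prob /= (bigD1 v) //= eqxx big1 ?addr0 // => x /negbTE ->.
Qed.

(* At most half of the vertices carry more than twice the uniform mass, so   *)
(* the excess over 2/n is always a function to which expansion applies.      *)
Definition excess t v x : R := Num.max (walk_prob t v x - 2 / #|V|%:R) 0.

Lemma excess_ge0 t v x : 0 <= excess t v x.
Proof. by rewrite le_max lexx orbT. Qed.

Let n_gt0 : 0 < #|V|%:R :> R.
Proof. by rewrite ltr0n; exact: ltnW. Qed.

Lemma excess_support t v :
  #|[set x | 0 < excess t v x]%SET|%:R <= #|V|%:R / 2 :> R.
Proof.
set S := [set x | _]%SET.
have : \sum_(x in S) (2 / #|V|%:R) <= 1 :> R.
  rewrite -[X in _ <= X](walk_prob_sum t v) [X in _ <= X](bigID (mem S)) /= -[X in X <= _]addr0.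
  rewrite lerD //; last by apply: sumr_ge0 => x _; exact: walk_prob_ge0.
  apply: ler_sum => x xS; have : 0 < excess t v x by move: xS; rewrite /S finset.inE.
  rewrite /excess lt_max ltxx orbF subr_gt0; exact: ltW.
by rewrite sumr_const -(mulr_natl (2 / _)) mulrA ler_pdivrMr // mul1r ler_pdivlMr.
Qed.

(** Averaging fixes the constant 2/n and preserves order, so the next excess is pointwise at most
    the average of the current one. Every excess has small support, so each step contracts. *)
Lemma excess_decay t v :
  \sum_x excess t v x ^+ 2 <= (1 - gap) ^+ t.
Proof.
have n0 := n_gt0.
elim: t => [|t IH].
  rewrite expr0; apply: le_trans (_ : \sum_x (x == v)%:R <= _); last first.
    by rewrite (bigD1 v) //= eqxx big1 ?addr0 // => x /negbTE ->.
  apply: ler_sum => x _; have n2 : 0 <= 2 / #|V|%:R :> R by rewrite divr_ge0 // ltW.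
  rewrite /excess /walk_prob /=.
  by case: eqVneq => _ /=; rewrite /Num.max; case: ifP => h; nra.
apply: le_trans (_ : \sum_x lazy_avg (excess t v) x ^+ 2 <= _).
  apply: ler_sum => x _.
  have A0 : 0 <= lazy_avg (excess t v) x.
    by apply: sumr_ge0 => y _; rewrite mulr_ge0 ?lazy_kernel_ge0 ?excess_ge0.
  rewrite lerXn2r ?nnegrE ?excess_ge0 // {1}/excess ge_max A0 andbT.
  rewrite lerBlDr -[X in _ + X]mul1r -[X in _ + X * _](lazy_kernel_sum x).
  rewrite mulr_suml -big_split.
  apply: ler_sum => y _; rewrite -/(walk_prob t v) /= -mulrDr ler_wpM2l ?lazy_kernel_ge0 //.
  by rewrite -lerBlDr /excess le_max lexx.
apply: le_trans (lazy_avg_contract (excess_ge0 t v) (excess_support t v)) _.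
by rewrite exprS ler_wpM2l ?subr_ge0 ?gap_le1.
Qed.

Lemma walk_prob_mixed t v x :
  (1 - gap) ^+ t <= #|V|%:R^-1 ^+ 2 -> walk_prob t v x <= 3 / #|V|%:R.
Proof.
move=> small; have n0 := n_gt0.
have : excess t v x ^+ 2 <= #|V|%:R^-1 ^+ 2.
  apply: le_trans small; apply: le_trans (excess_decay t v).
  rewrite [X in _ <= X](bigD1 x) //= lerDl.
  by apply: sumr_ge0 => y _; exact: sqr_ge0.
rewrite ler_pXn2r ?nnegrE ?excess_ge0 ?invr_ge0 ?(ltW n0)// /excess ge_max.
by case/andP => h _; lra.
Qed.

End Mixing.

(** * The adversary against deterministic algorithms *)

(** Positions are counted from one: the value is positive for every vertex of [s] and 0 for all
    others. *)
Definition last_visit (V : eqType) (s : seq V) (v : V) : nat :=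
  (size s - index v (rev s))%N.

Lemma last_visit_cat (V : eqType) (a b : seq V) v : v \notin b ->
  last_visit (a ++ b) v = last_visit a v.
Proof.
move=> vb; rewrite /last_visit rev_cat index_cat mem_rev (negbTE vb).
by rewrite size_cat size_rev addnC subnDl.
Qed.

Lemma last_visit_rcons (V : eqType) (s : seq V) v :
  last_visit (rcons s v) v = (size s).+1.
Proof. by rewrite /last_visit rev_rcons /= eqxx subn0 size_rcons. Qed.

Lemma last_visit_ge (V : eqType) (a b : seq V) v :
  (size a < last_visit (a ++ v :: b) v)%N.
Proof.
rewrite /last_visit rev_cat rev_cons cat_rcons size_cat /= index_cat.
have := index_size v (rev b); rewrite size_rev mem_rev /= eqxx.
have := index_mem v (rev b); rewrite size_rev mem_rev.
by case: ifP; lia.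
Qed.

Lemma split_last_visit (V : eqType) (s : seq V) v : v \in s ->
  exists a b, s = a ++ v :: b /\ v \notin b.
Proof.
elim: s => // x s IH; rewrite inE.
have [/IH[a [b [-> vb]]] _|vs] := boolP (v \in s).
  by exists (x :: a), b.
by rewrite orbF => /eqP <-; exists [::], s.
Qed.

Lemma sorted_adjacent (T : Type) (r : rel T) (a b : seq T) x y :
  sorted r (a ++ x :: y :: b) -> r x y.
Proof.
case: a => [|z a] /=; first by case/andP.
by rewrite cat_path /= => /and4P[].
Qed.

Section PathFunction.
Variables (R : realType) (V : finType) (e : rel V) (x0 : V) (D : V -> nat).
Hypothesis D_dec : forall v, v != x0 -> exists2 u, e v u & (D u < D v)%N.

(* A staircase descending along the walk x0 :: s, by the time of the last    *)
(* visit; the height function D leads back to x0 from everywhere else.       *)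
Definition path_fun (s : seq V) (v : V) : R :=
  if v \in x0 :: s then - (last_visit (x0 :: s) v)%:R else (D v)%:R.

(** Only a later visit to [v] can alter its value; hence queries that miss the future of the walk
    are answered correctly by a truncated walk. *)
Lemma path_fun_take m s v : v \notin drop m s ->
  path_fun (take m s) v = path_fun s v.
Proof.
move=> vd; have sE : x0 :: s = (x0 :: take m s) ++ drop m s.
  by rewrite cat_cons cat_take_drop.
by rewrite /path_fun sE mem_cat (negbTE vd) orbF last_visit_cat.
Qed.

(** Off the walk, a neighbour of smaller height has a smaller value, whether or not it is on the
    walk. On the walk, the vertex following the last visit differs from [v], hence is a genuine
    neighbour, and it has a later last visit. *)
Lemma path_fun_local_min s v : path (fun x y => (x == y) || e x y) x0 s ->
  local_min e (path_fun s) v -> v = last x0 s.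
Proof.
move=> ps vmin; have [vs|vs] := boolP (v \in x0 :: s); last first.
  have /D_dec[u vu Duv] : v != x0 by apply: contraNneq vs => ->; rewrite mem_head.
  have := vmin u vu; rewrite /path_fun (negbTE vs) leNgt => /negP[].
  case: ifP => _; last by rewrite ltr_nat.
  by rewrite (le_lt_trans (y := 0)) ?oppr_le0 // ltr0n; case: (D v) Duv.
have [a [b [sE vb]]] := split_last_visit vs.
case: b => [|u b] in sE vb *; first by rewrite -(last_cons x0) sE last_cat.
have vu : e v u.
  have /orP[/eqP vu|//] : (v == u) || e v u.
    by apply: (@sorted_adjacent _ (fun x y => (x == y) || e x y) a b); rewrite -sE.
  by move: vb; rewrite vu mem_head.
have := vmin u vu; rewrite /path_fun vs sE.
rewrite mem_cat !inE eqxx !orbT lerN2 ler_nat -cat_rcons.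
rewrite (last_visit_cat _ vb) last_visit_rcons leqNgt => /negP[].
by rewrite -(size_rcons a v) last_visit_ge.
Qed.

End PathFunction.

(** An output counts as one more guess at a vertex, so a correct answer is a hit just like a
    revealing query. *)
Definition target (R : realType) (V : finType) (A : det_alg R V)
    (h : seq (V * R)) : V :=
  match A h with Query v => v | Output v => v end.

(** Induction on [k]: the vertex queried at time [k] is the one computed from [F k], and every later
    [F i] answers it as [f] does. *)
Lemma history_hybrid (R : realType) (V : finType) (A : det_alg R V)
    (f : V -> R) (F : nat -> V -> R) N :
  (forall i j, (i < j <= N)%N ->
    F j (target A (history A (F i) i)) = f (target A (history A (F i) i))) ->
  forall k i, (k <= i <= N)%N -> history A (F i) k = history A f k.
Proof.
move=> Ff; elim=> [//|k IH] i /andP[ki iN] /=.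
rewrite IH ?(ltnW ki)//; have := Ff k i; rewrite ki iN => /(_ isT).
rewrite IH ?leqnn /= ?(leq_trans (ltnW ki))// /target.
by case: (A _) => // v ->.
Qed.

Definition success_within (R : realType) (V : finType) (e : rel V)
    (A : det_alg R V) (f : V -> R) (N : nat) : Prop :=
  exists v t, [/\ (t <= N)%N, A (history A f t) = Output v & local_min e f v].

Section Adversary.
Variables (R : realType) (V : finType) (e : rel V) (x0 : V) (D : V -> nat).
Hypothesis D_dec : forall v, v != x0 -> exists2 u, e v u & (D u < D v)%N.
Variables (A : det_alg R V) (M N : nat).
Hypothesis M_gt0 : (0 < M)%N.

Let L := (N.+1 * M)%N.

Let guess i (s : seq V) : V := target A (history A (path_fun R x0 D s) i).

Lemma success_hits_future s : size s = L ->
  path (fun x y => (x == y) || e x y) x0 s ->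
  success_within e A (path_fun R x0 D s) N ->
  exists2 i : 'I_N.+1, true & exists2 t : 'I_L, (i.+1 * M <= t.+1)%N &
    nth x0 (x0 :: s) t.+1 = guess i (take (i * M) s).
Proof.
move=> sL ps [v [t [tN Av vmin]]]; apply: contrapT => no_hit.
have miss i u : (i <= N)%N -> (i.+1 * M <= u.+1)%N -> (u < L)%N ->
    nth x0 s u != guess i (take (i * M) s).
  move=> iN iu uL; apply/eqP => hit; apply: no_hit.
  by exists (Ordinal (iN : (i < N.+1)%N)) => //; exists (Ordinal uL).
pose F i := path_fun R x0 D (take (i * M) s).
have hyb := @history_hybrid R V A (path_fun R x0 D s) F N.
have {}hyb : forall k i, (k <= i <= N)%N ->
    history A (F i) k = history A (path_fun R x0 D s) k.
  apply: hyb => i j /andP[ij jN]; apply: path_fun_take.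
  apply/negP => /(nthP x0)[u]; rewrite size_drop sL nth_drop => uL.
  apply/eqP; apply: miss; first by rewrite (leq_trans (ltnW ij)).
    have : (i.+1 * M <= j * M)%N by rewrite leq_mul2r ij orbT.
    by lia.
  by lia.
have vE : guess t (take (t * M) s) = v.
  by rewrite /guess /target hyb ?leqnn ?Av.
have L_gt0 : (0 < L)%N by rewrite muln_gt0 M_gt0.
have lastE : last x0 s = nth x0 s L.-1 by rewrite -sL nth_last.
(* The correct output is itself a hit, at the final time [L]: index [L.-1] of [s] is time [L] of the
   walk, and [t <= N] gives [t.+1 * M <= L]. *)
have := miss t L.-1 tN; rewrite prednK // leqnn leq_mul2r ltnS tN orbT.
by move=> /(_ isT isT); rewrite vE (path_fun_local_min D_dec ps vmin) lastE eqxx.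
Qed.

Variables (ker : V -> V -> R) (eps : R).
Hypotheses (ker_ge0 : forall x y, 0 <= ker x y).
Hypotheses (ker_sum : forall x, \sum_y ker x y = 1).
Hypotheses (ker_e : forall x y, 0 < ker x y -> (x == y) || e x y).
Hypothesis mixed : forall t v x, (M <= t)%N ->
  iter t (kernel_avg ker) (fun y => (y == v)%:R) x <= eps.

(** Union bound over [N.+1] guesses and [L] times. *)
Lemma success_walk_exp :
  walk_exp ker L x0
    (fun s => `[< success_within e A (path_fun R x0 D s) N >]%:R) <=
  (N.+1 * L)%:R * eps.
Proof.
apply: le_trans (_ : walk_exp ker L x0 (fun s =>
   \sum_(i < N.+1) \sum_(t < L | (i.+1 * M <= t.+1)%N)
     (nth x0 (x0 :: s) t.+1 == guess i (take (i * M) s))%:R) <= _).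
  apply: walk_exp_le => // s sL ps.
  have {}ps : path (fun x y => (x == y) || e x y) x0 s.
    by apply: sub_path ps => x y; exact: ker_e.
  case: asboolP => [suc|_]; last first.
    by apply: sumr_ge0 => i _; apply: sumr_ge0 => t _.
  have [i _ [t it hit]] := success_hits_future sL ps suc.
  have {}hit : nth x0 s t = guess i (take (i * M) s) := hit.
  rewrite (bigD1 i) //= (bigD1 t) //= hit eqxx -addrA lerDl addr_ge0 //.
    by apply: sumr_ge0.
  by apply: sumr_ge0 => j _; apply: sumr_ge0.
rewrite walk_exp_sum natrM -mulrA mulr_natl -[X in _ *+ X]card_ord -sumr_const.
apply: ler_sum => i _; rewrite walk_exp_sum.
rewrite mulr_natl -[X in _ *+ X]card_ord -sumr_const big_mkcond.
apply: ler_sum => t _; case: ifP => it.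
  apply: (walk_exp_guess ker_ge0 ker_sum mixed).
  by rewrite addnC -mulSn it ltn_ord.
(* A pair excluded by the guard contributes 0, and [eps] is nonnegative because it bounds a
   probability. *)
apply: le_trans (mixed x0 x0 (leqnn M)).
by apply: iter_kernel_avg_ge0.
Qed.

End Adversary.

(** * Randomized algorithms *)

Lemma take_pred_rcons (T : Type) (s : seq T) x :
  take (size (rcons s x)).-1 (rcons s x) = s.
Proof. by rewrite size_rcons -cats1 take_size_cat. Qed.

(** For fixed [f] the queried vertices determine the history, so only countably many histories occur
    although answers are real. This makes events about histories measurable. *)
Lemma history_queries (R : realType) (V : finType) (A : det_alg R V)
    (f : V -> R) t :
  exists s : seq V, history A f t = [seq (v, f v) | v <- s].
Proof.
elim: t => [|t [s IH]] /=; first by exists [::].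
case: (A _) => [v|_]; last by exists s.
by exists (rcons s v); rewrite IH map_rcons.
Qed.

(** Each step before halting adds one entry, so a time can be replaced by the number of queries
    made. *)
Lemma history_size (R : realType) (V : finType) (A : det_alg R V)
    (f : V -> R) t :
  history A f t = history A f (size (history A f t)).
Proof.
elim: t => [//|t IH] /=; case E : (A (history A f t)) => [v|//].
by rewrite size_rcons /= -IH E.
Qed.

Section Coins.
Variables (R : realType) (V : finType) (e : rel V) (A : rand_alg R V).
Variable f : V -> R.

Lemma history_measurable t h :
  measurable [set w | history (alg_of_coins A w) f t = h].
Proof.
elim: t h => [|t IH] h.
  case: h => [|a h] /=; first by rewrite (_ : [set _ | _] = setT) //; apply/seteqP; split.
  by rewrite (_ : [set _ | _] = set0) //; apply/seteqP; split.
(* Either the run had already stopped with history [h], or the last entry of [h] was just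
   queried. *)
have -> : [set w | history (alg_of_coins A w) f t.+1 = h] =
    ([set w | history (alg_of_coins A w) f t = h] `&`
       \bigcup_(v : V) [set w | alg_of_coins A w h = Output v]) `|`
    \bigcup_(v : V) [set w | [/\ (0 < size h)%N, last (v, f v) h = (v, f v),
        history (alg_of_coins A w) f t = take (size h).-1 h &
        alg_of_coins A w (take (size h).-1 h) = Query v]].
  apply/seteqP; split => w /=.
    case E : (alg_of_coins A w (history (alg_of_coins A w) f t)) => [v|v] <-.
      right; exists v => //=.
      by rewrite take_pred_rcons last_rcons size_rcons.
    by left; split => //; exists v.
  case=> [[-> [v _ /= ->]]//|[v _ /= [h0 lh hE Av]]].
  rewrite hE Av; case/lastP: h h0 lh {hE Av} => // h x _.
  by rewrite last_rcons take_pred_rcons => ->.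
apply: measurableU.
  apply: measurableI => //; apply: countable_bigcupT_measurable => // v.
  exact: alg_of_coins_measurable.
apply: countable_bigcupT_measurable => // v.
have [h0|h0] := pselect ((0 < size h)%N /\ last (v, f v) h = (v, f v)).
  rewrite (_ : [set _ | _] =
    [set w | history (alg_of_coins A w) f t = take (size h).-1 h] `&`
    [set w | alg_of_coins A w (take (size h).-1 h) = Query v]).
    by apply: measurableI => //; exact: alg_of_coins_measurable.
  by apply/seteqP; split=> w /= [] // *; case: h0 => *; split.
rewrite (_ : [set _ | _] = set0) //; apply/seteqP; split => w //= [h1 h2 _ _].
by apply: h0.
Qed.

Lemma history_event_measurable t (Q : seq (V * R) -> Prop) :
  measurable [set w | Q (history (alg_of_coins A w) f t)].
Proof.
have -> : [set w | Q (history (alg_of_coins A w) f t)] =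
    \bigcup_(s : seq V) ([set w | history (alg_of_coins A w) f t =
      [seq (v, f v) | v <- s]] `&` [set w | Q [seq (v, f v) | v <- s]]).
  apply/seteqP; split => w /=; last by case=> s _ [/= ->].
  have [s sE] := history_queries (alg_of_coins A w) f t.
  by move=> Qw; exists s => //=; rewrite -sE.
apply: countable_bigcupT_measurable => // s; apply: measurableI.
  exact: history_measurable.
have [q|q] := pselect (Q [seq (v, f v) | v <- s]).
  by rewrite (_ : [set _ | _] = setT) //; apply/seteqP; split.
by rewrite (_ : [set _ | _] = set0) //; apply/seteqP; split.
Qed.

Lemma output_measurable t v :
  measurable [set w | alg_of_coins A w (history (alg_of_coins A w) f t) = Output v].
Proof.
have -> : [set w | alg_of_coins A w (history (alg_of_coins A w) f t) = Output v] =
    \bigcup_(s : seq V) ([set w | history (alg_of_coins A w) f t =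
      [seq (v, f v) | v <- s]] `&`
      [set w | alg_of_coins A w [seq (v, f v) | v <- s] = Output v]).
  apply/seteqP; split => w /=; last by case=> s _ [/= ->].
  have [s sE] := history_queries (alg_of_coins A w) f t.
  by move=> Qw; exists s => //=; rewrite -sE.
apply: countable_bigcupT_measurable => // s; apply: measurableI.
  exact: history_measurable.
exact: alg_of_coins_measurable.
Qed.

Lemma success_within_measurable N :
  measurable [set w | success_within e (alg_of_coins A w) f N].
Proof.
have -> : [set w | success_within e (alg_of_coins A w) f N] =
    \bigcup_(v in [set v | local_min e f v]) \bigcup_(t in [set t | (t <= N)%N])
      [set w | alg_of_coins A w (history (alg_of_coins A w) f t) = Output v].
  apply/seteqP; split => w /=.
    by case=> v [t [tN Av vmin]]; exists v => //; exists t.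
  by case=> v vmin [t tN Av]; exists v, t.
apply: fin_bigcup_measurable; first exact: finite_finset.
move=> v _; apply: bigcup_measurable => t _; exact: output_measurable.
Qed.

Lemma num_queries_measurable :
  measurable_fun setT
    ((fun w => num_queries (alg_of_coins A w) f) : coins A -> \bar R).
Proof.
have -> : (fun w => num_queries (alg_of_coins A w) f) =
    (fun w => esups (fun t => (size (history (alg_of_coins A w) f t))%:R%:E) 0%N).
  apply/funext => w; rewrite /num_queries /esups /sdrop; congr ereal_sup.
  by apply/seteqP; split => x [t _ <-]; exists t.
apply: measurable_fun_esups => t _ Y _; rewrite setTI.
exact: (history_event_measurable t (fun h => Y (size h)%:R%:E)).
Qed.

Lemma many_queries_measurable N : measurable [set w | exists t,
  (N < size (history (alg_of_coins A w) f t))%N].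
Proof.
have -> : [set w | exists t, (N < size (history (alg_of_coins A w) f t))%N] =
    \bigcup_t [set w | (N < size (history (alg_of_coins A w) f t))%N].
  by apply/seteqP; split => w /=; [case=> t ?; exists t|case=> t _ ?; exists t].
apply: bigcupT_measurable => t.
exact: (history_event_measurable t (fun h => (N < size h)%N)).
Qed.

Lemma markov_queries N :
  ((N.+1%:R)%:E * coin_law A [set w | exists t,
     (N < size (history (alg_of_coins A w) f t))%N] <= expected_queries A f)%E.
Proof.
set B := [set w | _].
have mB : measurable B by exact: many_queries_measurable.
rewrite -[B]setIT -integral_indic // -ge0_integralZl_EFin //; last first.
  by apply/measurable_EFinP; exact: measurable_indic.
apply: ge0_le_integral => //.
- apply: measurable_funeM; apply/measurable_EFinP; exact: measurable_indic.
- exact: num_queries_measurable.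
move=> w _; rewrite indicE.
have [|_] := boolP (w \in B); last first.
  rewrite mule0; apply: ereal_sup_ge; exists 0%:E => //.
  by exists 0%N.
rewrite inE => -[t Nt]; rewrite mule1; apply: ereal_sup_ge.
exists (size (history (alg_of_coins A w) f t))%:R%:E; first by exists t.
by rewrite lee_fin ler_nat.
Qed.

(** By Markov's inequality more than [N] queries are made with probability at most 1/10, which is
    subtracted from 9/10. *)
Lemma success_within_prob N :
  ((9 / 10 : R)%:E <= success_prob e A f)%E ->
  (expected_queries A f <= (N.+1%:R / 10)%:E)%E ->
  ((8 / 10 : R)%:E <=
     coin_law A [set w | success_within e (alg_of_coins A w) f N])%E.
Proof.
move=> suc few; have mark := le_trans (markov_queries N) few.
rewrite /success_prob in suc.
set S := [set w | exists v, _] in suc; set B := [set w | exists t, _] in mark.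
set SN := [set w | success_within _ _ _ _].
have mB : measurable B by exact: many_queries_measurable.
have mSN : measurable SN by exact: success_within_measurable.
have mS : measurable S.
  have -> : S = \bigcup_N [set w | success_within e (alg_of_coins A w) f N].
    apply/seteqP; split => w /=.
      by case=> v [[t Av] vmin]; exists t => //; exists v, t.
    by case=> k _ [v [t [_ Av vmin]]]; exists v; split => //; exists t.
  by apply: bigcupT_measurable => k; exact: success_within_measurable.
have SB : S `<=` SN `|` B.
  move=> w [v [[t Av] vmin]].
  have [|tN] := ltnP N (size (history (alg_of_coins A w) f t)).
    by right; exists t.
  left; exists v, (size (history (alg_of_coins A w) f t)); split => //.
  by rewrite -history_size.
have le1 : (coin_law A S <= coin_law A SN + coin_law A B)%E.
  apply: le_trans (measureU2 _ _ _) => //.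
  by apply: le_measure; rewrite ?inE //; exact: measurableU.
have fB := fin_num_measure (coin_law A) B mB.
have fSN := fin_num_measure (coin_law A) SN mSN.
move: (le_trans suc le1) mark.
rewrite -(fineK fB) -(fineK fSN) -EFinD -EFinM !lee_fin => h1 h2.
have : fine (coin_law A B) <= 1 / 10.
  by rewrite -(@ler_pM2l _ N.+1%:R) ?ltr0n // mulrA mulr1.
by lra.
Qed.

End Coins.

(** The exchange of walk and coins behind Yao's principle. Measurability is carried along because
    the induction integrates the inner expectation. *)
Lemma walk_exp_measure (dsp : measure_display) (T : measurableType dsp)
    (R : realType) (P : probability T R) (V : finType) (ker : V -> V -> R)
    (ker_ge0 : forall x y, 0 <= ker x y) L x (B : seq V -> set T) :
  (forall s, measurable (B s)) ->
  measurable_fun setT (fun w => walk_exp ker L x (fun s => \1_(B s) w)) /\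
  (\int[P]_w (walk_exp ker L x (fun s => \1_(B s) w))%:E =
    (walk_exp ker L x (fun s => fine (P (B s))))%:E)%E.
Proof.
elim: L x B => [|L IH] x B mB /=.
  split; first exact: measurable_indic.
  by rewrite integral_indic // setIT fineK // fin_num_measure.
have mW y : measurable_fun setT
    (fun w => walk_exp ker L y (fun s => \1_(B (y :: s)) w)).
  exact: (IH y (fun s => B (y :: s)) (fun s => mB (y :: s))).1.
have W0 y w : 0 <= walk_exp ker L y (fun s => \1_(B (y :: s)) w).
  by apply: walk_exp_ge0 => // s; rewrite indicE.
split.
  apply: measurable_sum => y; apply: measurable_funM => //; exact: mW.
under eq_integral do rewrite -sumEFin.
rewrite ge0_integral_sum //.
- rewrite -sumEFin; apply: eq_bigr => y _.
  under eq_integral do rewrite EFinM.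
  rewrite ge0_integralZl_EFin //.
  + by rewrite (IH y (fun s => B (y :: s)) (fun s => mB (y :: s))).2.
  + by move=> w _; rewrite lee_fin.
  + exact/measurable_EFinP/mW.
- by move=> y; apply/measurable_EFinP; apply: measurable_funM => //; exact: mW.
- by move=> y w _; rewrite lee_fin mulr_ge0.
Qed.

(** With fewer expected queries, every [f] is solved within [N] steps with probability at least 8/10
    over the coins, hence also on average over the walk; but for each fixed coin outcome the walk
    average is at most 1/2. *)
Lemma walk_lower_bound (R : realType) (V : finType) (e : rel V) (x0 : V)
    (D : V -> nat) (M N : nat) (ker : V -> V -> R) (eps : R) :
  (forall v, v != x0 -> exists2 u, e v u & (D u < D v)%N) ->
  (0 < M)%N ->
  (forall x y, 0 <= ker x y) -> (forall x, \sum_y ker x y = 1) ->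
  (forall x y, 0 < ker x y -> (x == y) || e x y) ->
  (forall t v x, (M <= t)%N ->
    iter t (kernel_avg ker) (fun y => (y == v)%:R) x <= eps) ->
  (N.+1 * (N.+1 * M))%:R * eps <= 1 / 2 ->
  ((N.+1%:R / 10)%:E <= randomized_query_complexity R e)%E.
Proof.
move=> D_dec M0 ker_ge0 ker_sum ker_e mixed small.
apply: le_ereal_inf_tmp => _ [A solves ->]; rewrite leNgt; apply/negP => few.
pose L := (N.+1 * M)%N.
pose B s := [set w | success_within e (alg_of_coins A w) (path_fun R x0 D s) N].
have PB s : 8 / 10 <= fine (coin_law A (B s)).
  rewrite -lee_fin fineK ?fin_num_measure //; last exact: success_within_measurable.
  apply: success_within_prob; first exact: solves.
  apply: le_trans (ltW few); apply: ereal_sup_ubound.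
  by exists (path_fun R x0 D s).
have [mW intW] := walk_exp_measure (coin_law A) ker_ge0 L x0
  (fun s => success_within_measurable e A (path_fun R x0 D s) N : measurable (B s)).
have : ((walk_exp ker L x0 (fun s => fine (coin_law A (B s))))%:E <= (1 / 2)%:E)%E.
  rewrite -intW; apply: le_trans (_ : \int[coin_law A]_w (1 / 2)%:E <= _)%E; last first.
    rewrite integral_cst // [X in (_ * X)%E](_ : _ = 1%E) ?mule1 //.
    exact: probability_setT.
  apply: ge0_le_integral => //.
  - move=> w _; rewrite lee_fin; apply: walk_exp_ge0 => // s; rewrite indicE.
  - exact/measurable_EFinP.
  move=> w _; rewrite lee_fin; apply: le_trans small.
  exact: (success_walk_exp D_dec (alg_of_coins A w) N M0 ker_ge0 ker_sum ker_e mixed).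
rewrite lee_fin => h.
have : 8 / 10 <= walk_exp ker L x0 (fun s => fine (coin_law A (B s))).
  rewrite -(walk_exp_cst ker_sum L x0 (8 / 10)).
  by apply: walk_exp_le.
by move: h; lra.
Qed.

(** * Connectivity, numerical estimates and the choice of constants *)

(** A component and its complement both have empty boundary, so if both were nonempty each would
    contain more than half of the vertices. *)
Lemma expander_connected (R : realType) (V : finType) (e : rel V) (beta : R) :
  symmetric e -> 0 < beta -> expander e beta -> forall x y, connect e x y.
Proof.
move=> e_sym beta0 exp_e x y.
have closed_half (S : {set V}) : (0 < #|S|)%N -> edge_boundary e S = finset.set0 ->
    #|V|%:R / 2 < #|S|%:R :> R.
  move=> S0 bS; rewrite ltNge; apply/negP => /(exp_e _ S0).
  by rewrite bS cards0 leNgt mulr_gt0 // ltr0n.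
pose S := [set z | connect e x z]%SET.
have bS : edge_boundary e S = finset.set0.
  apply/setP => -[u v]; rewrite !finset.inE /=; apply/negP => /and3P[uv xu].
  by rewrite (connect_trans xu) // connect1.
have bSC : edge_boundary e (~: S)%SET = finset.set0.
  apply/setP => -[u v]; rewrite !finset.inE /=; apply/negP => /and3P[uv xu].
  rewrite negbK => xv; move/negP: xu; apply.
  by rewrite (connect_trans xv) // connect1 // e_sym.
have [yS|yS] := boolP (y \in S); first by rewrite finset.inE in yS.
have h1 : #|V|%:R / 2 < #|S|%:R :> R.
  by apply: closed_half => //; apply/card_gt0P; exists x; rewrite finset.inE.
have h2 : #|V|%:R / 2 < #|(~: S)%SET|%:R :> R.
  by apply: closed_half => //; apply/card_gt0P; exists y; rewrite finset.in_setC.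
have : #|V|%:R = #|S|%:R + #|(~: S)%SET|%:R :> R by rewrite -natrD cardsC.
by lra.
Qed.

(** [D] is the distance to [x0]; the first step of a shortest path decreases it. *)
Lemma connected_descent (V : finType) (e : rel V) (x0 : V) :
  (forall v, connect e v x0) ->
  exists D : V -> nat, forall v, v != x0 -> exists2 u, e v u & (D u < D v)%N.
Proof.
move=> conn.
pose reach v k := [exists p : k.-tuple V, path e v p && (last v p == x0)].
have ex v : exists k, reach v k.
  have /connectP[p ep pE] := conn v; exists (size p).
  by apply/existsP; exists (in_tuple p); rewrite ep pE eqxx.
exists (fun v => ex_minn (ex v)) => v vx0.
case: (ex_minnP (ex v)) => k /existsP[[p pk] /= /andP[ep /eqP pE]] _.
case: p => [|u p] /= in pk ep pE; first by rewrite pE eqxx in vx0.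
case/andP: ep => vu ep; exists u => //.
case: ex_minnP => j _ minj; rewrite -(eqP pk) ltnS; apply: minj.
by apply/existsP; exists (in_tuple p); rewrite ep pE eqxx.
Qed.

(** Here [r] is the square root of n and [l] its logarithm ln n. In the expansion of
    [(N + 1) ^+ 2 * M] the term [N * N * M] is at most [r ^+ 2 / 576], [M] is at most [r ^+ 2 / 24],
    and the cross term is at most their sum. *)
Lemma budget_bound (R : realFieldType) (K l r N M : R) :
  1 <= K -> 1 <= l -> l <= 2 * r -> 48 * K <= r -> 0 <= N ->
  N * (24 * K * l) <= r -> 0 <= M <= K * l ->
  (N + 1) * ((N + 1) * M) * 3 <= r ^+ 2 / 2.
Proof.
move=> K1 l1 lr Kr N0 Nr /andP[M0 MK].
have r0 : 0 <= r by lra.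
have Nl : N * K * l <= r / 24 by lra.
have NM : N * N * M <= N * N * (K * l) by rewrite ler_wpM2l // mulr_ge0.
have Nr' : N <= r / 24.
  apply: le_trans Nl; rewrite -mulrA ler_peMr //.
  by rewrite -[leLHS]mulr1 ler_pM.
have NNM : N * N * (K * l) <= r / 24 * (r / 24).
  have -> : N * N * (K * l) = N * (N * K * l) by ring.
  by apply: ler_pM => //; rewrite !mulr_ge0 //; lra.
have MM : M <= r ^+ 2 / 24.
  apply: le_trans MK _; apply: le_trans (_ : K * (2 * r) <= _).
    by rewrite ler_wpM2l //; lra.
  have : 48 * K * r <= r * r by rewrite ler_wpM2r.
  by rewrite expr2; lra.
have NM1 : 2 * N * M <= N * N * M + M.
  have : 0 <= (N - 1) ^+ 2 * M by rewrite mulr_ge0 // sqr_ge0.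
  have -> : (N - 1) ^+ 2 * M = N * N * M + M - 2 * N * M by ring.
  by lra.
have -> : (N + 1) * ((N + 1) * M) * 3 = 3 * (N * N * M + 2 * N * M + M) by ring.
have rr : r / 24 * (r / 24) = r ^+ 2 / 576 by field.
have := sqr_ge0 r; rewrite rr in NNM; lra.
Qed.

(** Uses 1 - g <= exp(-g), so 2 ln x / g steps reach the level of the inverse square of [x]. *)
Lemma expR_decay (R : realType) (g x : R) (M t : nat) :
  0 < g <= 1 -> 0 < x -> 2 / g * ln x <= M%:R -> (M <= t)%N ->
  (1 - g) ^+ t <= x^-1 ^+ 2.
Proof.
move=> /andP[g0 g1] x0 Mx Mt.
apply: le_trans (_ : expR (t%:R * - g) <= _).
  rewrite expRM_natl lerXn2r ?nnegrE ?subr_ge0 ?expR_ge0 //.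
  exact: expR_ge1Dx.
have -> : x^-1 ^+ 2 = expR (2%:R * - ln x).
  by rewrite expRM_natl expRN lnK.
rewrite ler_expR.
have Mt' : M%:R <= t%:R :> R by rewrite ler_nat.
have : 2 / g * ln x <= t%:R by exact: le_trans Mt'.
by rewrite mulrAC ler_pdivrMr //; lra.
Qed.

Theorem corollary1 (R : realType) (d : nat) (beta : R) (beta_gt0 : 0 < beta) :
  exists (c : R) (n0 : nat), 0 < c /\
    forall (V : finType) (e : rel V),
      simple_graph e -> regular e d -> expander e beta -> (n0 <= #|V|)%N ->
      ((c * (Num.sqrt #|V|%:R / ln #|V|%:R))%:E
         <= randomized_query_complexity R e)%E.
Proof.
pose g := gap d beta; pose K : R := 2 / g + 1.
(* Without a graph [d] may be 0; division by zero then gives [g = 0] and [K = 1]. Positivity of [g]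
   comes later, from expansion. *)
have g_ge0 : 0 <= g by rewrite divr_ge0 ?mulr_ge0 ?exprn_ge0 // ltW.
have K1 : 1 <= K by rewrite lerDr divr_ge0.
have K0 : 0 < K by exact: lt_le_trans K1.
(* The factor 240 is 24 from the choice of [N] times 10 from Markov. The thresholds ensure at least
   two vertices, ln n >= 1 and sqrt n >= 48 K. *)
exists (240 * K)^-1, (maxn 2 (maxn (Num.truncn (expR (1 : R))).+1 (Num.truncn ((48 * K) ^+ 2)).+1)).
split; first by rewrite invr_gt0 mulr_gt0.
move=> V e graph_e reg_e exp_e; rewrite !geq_max => /and3P[V1 Ve VK].
set n := #|V| in V1 Ve VK *; set l := ln n%:R; set r := Num.sqrt n%:R.
have n0 : 0 < n%:R :> R by rewrite ltr0n; exact: ltnW.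
have l1 : 1 <= l.
  rewrite -ler_expR lnK //; apply: le_trans (ltW (truncnS_gt _)) _.
  by rewrite ler_nat.
have r0 : 0 < r by rewrite sqrtr_gt0.
have rn : r ^+ 2 = n%:R by rewrite sqr_sqrtr // ltW.
have lr : l <= 2 * r.
  by rewrite /l -rn lnXn // -[leLHS]mulr_natl ler_wpM2l // ltW // ln_sublinear.
have Kr : 48 * K <= r.
  rewrite -(@ler_pXn2r _ 2) ?nnegrE ?mulr_ge0 ?(ltW K0) ?(ltW r0) // rn.
  by apply: le_trans (ltW (truncnS_gt _)) _; rewrite ler_nat.
have l0 : 0 < l by exact: lt_le_trans l1.
(* [M] is the mixing time; since [l >= 1], rounding up is paid for by the summand 1 in [K]. *)
pose M := (Num.truncn (2 / g * l)).+1; pose N := Num.truncn (r / (24 * K * l)).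
have g0 : 0 < g by exact: gap_gt0 beta_gt0 exp_e V1.
have M_low : 2 / g * l <= M%:R by exact/ltW/truncnS_gt.
have M_high : M%:R <= K * l.
  have h : (Num.truncn (2 / g * l))%:R <= 2 / g * l.
    by rewrite truncn_le; apply: mulr_ge0 (ltW l0); rewrite divr_ge0.
  have -> : K * l = 2 / g * l + l by rewrite mulrDl mul1r.
  by rewrite -[leLHS]natr1; lra.
have Kl0 : 0 < 24 * K * l by rewrite !mulr_gt0.
have N_low : N%:R * (24 * K * l) <= r.
  by rewrite -ler_pdivlMr // truncn_le divr_ge0 // ltW.
have N_high : (240 * K)^-1 * (r / l) <= N.+1%:R / 10.
  have := ltW (truncnS_gt (r / (24 * K * l))); rewrite -/N => h.
  have -> : (240 * K)^-1 * (r / l) = r / (24 * K * l) / 10.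
    by field; rewrite !lt0r_neq0.
  by rewrite ler_pM2r // invr_gt0.
have /card_gt0P[x0 _] : (0 < #|V|)%N by exact: ltnW.
have [D D_dec] : exists D : V -> nat,
    forall v, v != x0 -> exists2 u, e v u & (D u < D v)%N.
  by apply: connected_descent => v; apply: expander_connected graph_e.1 beta_gt0 exp_e v x0.
apply: le_trans (_ : (N.+1%:R / 10)%:E <= _)%E; first by rewrite lee_fin.
apply: (@walk_lower_bound R V e x0 D M N (lazy_kernel R e d) (3 / n%:R)) => //.
- exact: lazy_kernel_ge0.
- exact: lazy_kernel_sum beta_gt0 exp_e V1.
- move=> x y; rewrite /lazy_kernel.
  by case: (x == y); case: (e x y) => //=; rewrite mul0r addr0 mul0r ltxx.
- move=> t v x Mt; apply: (walk_prob_mixed graph_e reg_e beta_gt0 exp_e V1).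
  apply: expR_decay M_low Mt => //.
  by rewrite g0; exact: gap_le1 reg_e beta_gt0 exp_e V1.
rewrite mulrA ler_pdivrMr // -rn mulrAC mul1r 2!natrM -natr1.
apply: budget_bound K1 l1 lr Kr _ N_low _ => //.
by rewrite M_high andbT.
Qed.
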